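(* Let $(t^*,\lambda^* )$ be an optimal solution of the problem $$\max_{t\in\mathbb{R},\ \lambda\ge 0}\ k(t,\lambda)=(\Delta+1)\lambda_{\min}(D(t,\lambda))-t-\lambda c .$$ Then strong duality fails for eTRS if and only if both of the following hold: 1. $\lambda_{\min}(D(t^*,\lambda^* ))=\lambda_{\min}(A)<0$ and $\lambda^*>0$; 2. $\lambda_{\min}(A)$ has multiplicity one and the linear system $(A-\lambda_{\min}(A)I)x=a-\frac{\lambda^*}{2}b$ has two solutions $x_1$ and $x_2$ satisfying $x_i^Tx_i=\Delta$ for $i=1,2$ and $(b^Tx_1-c)(b^Tx_2-c)<0$.
   Context: Let $A\in\mathbb{R}^{n\times n}$ be symmetric and not positive definite, $a,b\in\mathbb{R}^n$, $c,\Delta\in\mathbb{R}$ with $\Delta>0$. The extended trust region subproblem (eTRS) is $$p^*:=\min\ x^TAx-2a^Tx\quad\text{subject to}\quad \|x\|^2\le\Delta,\ \ b^Tx\le c .$$ Standing assumption (Slater condition): there is $\hat x\in\mathbb{R}^n$ with $\|\hat x\|^2<\Delta$ and $b^T\hat x<c$. The norm is the Euclidean norm, and $\lambda_{\min}(S)$ denotes the smallest eigenvalue of a symmetric matrix $S$. For $t,\lambda\in\mathbb{R}$, $$D(t,\lambda)=\begin{bmatrix} t & (-a+\frac{\lambda}{2}b)^T\\ -a+\frac{\lambda}{2}b & A\end{bmatrix}\in\mathbb{R}^{(n+1)\times(n+1)} .$$ The Lagrangian dual value of eTRS is $$d^*:=\max_{\lambda_1,\lambda_2\ge0}\ \min_{x\in\mathbb{R}^n}\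 x^TAx-2a^Tx+\lambda_1(\|x\|^2-\Delta)+\lambda_2(b^Tx-c),$$ and strong duality holds for eTRS if $p^*=d^*$; it fails otherwise. *)

(* Defs.v *)
From mathcomp Require Import all_boot all_order all_algebra.
From mathcomp Require Import all_classical all_reals all_analysis.

Set Implicit Arguments.
Unset Strict Implicit.
Unset Printing Implicit Defensive.

Import Order.TTheory GRing.Theory Num.Theory.

Local Open Scope classical_set_scope.
Local Open Scope ring_scope.

Section EigenvaluesAndForms.
Context {R : realType}.

Definition dotp n (u v : 'cV[R]_n) : R := (u^T *m v) 0 0.

(* The norm that the library puts on matrices is the sup norm, hence this one. *)
Definition enorm n (x : 'cV[R]_n) : R := Num.sqrt (dotp x x).

Definition quadf n (A : 'M[R]_n) (x : 'cV[R]_n) : R := (x^T *m A *m x) 0 0.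

Definition posdef n (A : 'M[R]_n) : Prop :=
  forall x : 'cV[R]_n, x != 0 -> 0 < quadf A x.

(* The default value 0 is only taken by matrices without real eigenvalues, so
   never by a symmetric matrix of positive size. *)
Definition lambda_min n (S : 'M[R]_n) : R :=
  xget 0 [set mu | eigenvalue S mu /\ forall nu, eigenvalue S nu -> mu <= nu].

Definition multiplicity n (S : 'M[R]_n) (mu : R) : nat := mup mu (char_poly S).

End EigenvaluesAndForms.

Section ExtendedTrustRegion.
Context {R : realType} (n : nat).
Variables (A : 'M[R]_n) (a b : 'cV[R]_n) (c Delta : R).

Definition etrs_obj (x : 'cV[R]_n) : R := quadf A x - 2 * dotp a x.

Definition etrs_feasible : set 'cV[R]_n :=
  [set x | enorm x ^+ 2 <= Delta /\ dotp b x <= c].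

Definition slater : Prop :=
  exists x : 'cV[R]_n, enorm x ^+ 2 < Delta /\ dotp b x < c.

Definition etrs_lagrangian (l1 l2 : R) (x : 'cV[R]_n) : R :=
  etrs_obj x + l1 * (enorm x ^+ 2 - Delta) + l2 * (dotp b x - c).

Definition primal_value : \bar R :=
  ereal_inf [set (etrs_obj x)%:E | x in etrs_feasible].

(* The inner infimum is -oo where the Lagrangian is unbounded below. *)
Definition dual_function (l1 l2 : R) : \bar R :=
  ereal_inf [set (etrs_lagrangian l1 l2 x)%:E | x in [set: 'cV[R]_n]].

Definition dual_value : \bar R :=
  ereal_sup [set dual_function l.1 l.2 | l in [set l : R * R | 0 <= l.1 /\ 0 <= l.2]].

Definition strong_duality : Prop := primal_value = dual_value.

Definition Dmx (t lambda : R) : 'M[R]_(1 + n) :=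
  let v := - a + (lambda / 2) *: b in block_mx t%:M v^T v A.

Definition kfun (t lambda : R) : R :=
  (Delta + 1) * lambda_min (Dmx t lambda) - t - lambda * c.

Definition kfun_optimal (t lambda : R) : Prop :=
  0 <= lambda /\ forall t' lambda' : R, 0 <= lambda' -> kfun t' lambda' <= kfun t lambda.

End ExtendedTrustRegion.

(* Main.v *)
Require Import Defs.
From mathcomp Require Import all_boot all_order all_algebra.
From mathcomp Require Import all_classical all_reals all_analysis.
From mathcomp Require Import ring lra zify.

Set Implicit Arguments.
Unset Strict Implicit.
Unset Printing Implicit Defensive.

Import Order.TTheory GRing.Theory Num.Theory.
Import numFieldNormedType.Exports.
Local Open Scope ring_scope.

(** Write [a_l] for [a - (l / 2) b] and consider, for each multiplier [l] of the
    linear constraint, the minimum of the partial Lagrangian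
    [x^T A x - 2 a^T x + l (b^T x - c)] over the sphere [|x|^2 = Delta]. Evaluating
    the quadratic form of [Dmx t l] at (1, x) shows that [k t l] never exceeds
    this minimum ([kfun_le_lagrangian]), and for a suitable [t] it is equal to it
    ([kfun_attains]). Hence an optimal [(t, l)] maximises the sphere minimum over
    [l >= 0], and a minimiser [x] for the optimal [l] makes (1, x) an eigenvector
    of [Dmx t l] for its smallest eigenvalue [s], so that [(A - s) x = a_l]
    with [A - s] positive semidefinite. The attainment in [t] rests on the
    hidden convexity of the sphere problem: a global minimiser satisfies such a
    second order condition for every direction ([sphere_min_kkt]).

    As [A] is not positive definite, [s <= 0], so that [- s] is an admissible
    multiplier of the norm constraint. A point [x] with [(A - s) x = a_l],
    [|x|^2 <= Delta], [s (|x|^2 - Delta) = 0], [b^T x <= c] and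
    [l (b^T x - c) = 0] therefore certifies strong duality ([kkt_strong_duality]).

    If strong duality fails, optimality of [l] in both directions
    ([optimal_one_sided]) forces [l > 0] and gives minimisers [x1], [x2] with
    [b^T x1 < c < b^T x2]. Their difference is an eigenvector of [A] for [s], so
    [s] is the smallest eigenvalue of [A]. If [s = 0] or if the eigenspace had
    dimension at least two, one could pass from [x1] to [x2] inside the set defined by
    the first three of these conditions and meet [b^T x = c] at a certificate
    ([gap_multipliers]). The eigenspace dimension is the multiplicity in the
    characteristic polynomial because [A] is symmetric ([multiplicity_sym]).

    Conversely [x1] and [x2], lying on opposite sides of the hyperplane, pin down
    the dual value, and a primal solution with this value would be a third point
    of the sphere on the line through [x1] and [x2] ([multipliers_gap]). *)

(** * Dot products and quadratic forms *)

Section DotProduct.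
Context {R : realType}.

Lemma dotpE n (u v : 'cV[R]_n) : dotp u v = \sum_i u i 0 * v i 0.
Proof. by rewrite /dotp !mxE; apply: eq_bigr => i _; rewrite !mxE. Qed.

Lemma dotpC n (u v : 'cV[R]_n) : dotp u v = dotp v u.
Proof. by rewrite !dotpE; apply: eq_bigr => i _; rewrite mulrC. Qed.

Lemma dotpDl n (u v w : 'cV[R]_n) : dotp (u + v) w = dotp u w + dotp v w.
Proof. by rewrite /dotp linearD mulmxDl mxE. Qed.

Lemma dotpDr n (u v w : 'cV[R]_n) : dotp w (u + v) = dotp w u + dotp w v.
Proof. by rewrite /dotp mulmxDr mxE. Qed.

Lemma dotpZl n s (u v : 'cV[R]_n) : dotp (s *: u) v = s * dotp u v.
Proof. by rewrite /dotp linearZ -scalemxAl mxE. Qed.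

Lemma dotpZr n s (u v : 'cV[R]_n) : dotp u (s *: v) = s * dotp u v.
Proof. by rewrite /dotp -scalemxAr mxE. Qed.

Lemma dotpNl n (u v : 'cV[R]_n) : dotp (- u) v = - dotp u v.
Proof. by rewrite /dotp linearN mulNmx mxE. Qed.

Lemma dotpNr n (u v : 'cV[R]_n) : dotp u (- v) = - dotp u v.
Proof. by rewrite /dotp mulmxN mxE. Qed.

Lemma dotp0l n (u : 'cV[R]_n) : dotp 0 u = 0.
Proof. by rewrite /dotp linear0 mul0mx mxE. Qed.

Lemma dotp0r n (u : 'cV[R]_n) : dotp u 0 = 0.
Proof. by rewrite dotpC dotp0l. Qed.

Lemma dotp_ge0 n (u : 'cV[R]_n) : 0 <= dotp u u.
Proof. by rewrite dotpE; apply: sumr_ge0 => i _; rewrite -expr2 sqr_ge0. Qed.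

Lemma dotp_eq0 n (u : 'cV[R]_n) : (dotp u u == 0) = (u == 0).
Proof.
apply/idP/eqP => [|->]; last by rewrite dotp0l.
rewrite dotpE psumr_eq0 => [/allP h|i _]; last by rewrite -expr2 sqr_ge0.
apply/matrixP => i j; rewrite ord1 mxE; apply/eqP.
by have := h i (mem_index_enum _); rewrite mulf_eq0 orbb.
Qed.

Lemma dotp_gt0 n (u : 'cV[R]_n) : (0 < dotp u u) = (u != 0).
Proof. by rewrite lt0r dotp_ge0 andbT dotp_eq0. Qed.

Lemma enorm_sqr n (u : 'cV[R]_n) : enorm u ^+ 2 = dotp u u.
Proof. by rewrite sqr_sqrtr ?dotp_ge0. Qed.

Lemma quadfE n (A : 'M[R]_n) (x : 'cV[R]_n) : quadf A x = dotp x (A *m x).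
Proof. by rewrite /quadf /dotp mulmxA. Qed.

Lemma dotp_sym {n} {A : 'M[R]_n} : A^T = A ->
  forall u v, dotp u (A *m v) = dotp v (A *m u).
Proof. by move=> As u v; rewrite dotpC /dotp trmx_mul As mulmxA. Qed.

Lemma quadfZ n (A : 'M[R]_n) s (x : 'cV[R]_n) :
  quadf A (s *: x) = s ^+ 2 * quadf A x.
Proof. by rewrite !quadfE -scalemxAr dotpZl dotpZr; ring. Qed.

Lemma quadf0 n (A : 'M[R]_n) : quadf A 0 = 0.
Proof. by rewrite quadfE dotp0l. Qed.

Lemma quadfD n (A : 'M[R]_n) (x y : 'cV[R]_n) : A^T = A ->
  quadf A (x + y) = quadf A x + 2 * dotp y (A *m x) + quadf A y.
Proof.
move=> As; rewrite !quadfE mulmxDr dotpDl !dotpDr (dotp_sym As x y); ring.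
Qed.

Lemma quadf_shift n (A : 'M[R]_n) s (x : 'cV[R]_n) :
  quadf (A - s%:M) x = quadf A x - s * dotp x x.
Proof.
by rewrite !quadfE mulmxBl mul_scalar_mx dotpDr dotpNr dotpZr.
Qed.

Lemma shift_sym n (A : 'M[R]_n) s : A^T = A -> (A - s%:M)^T = A - s%:M.
Proof. by move=> As; rewrite linearB /= As tr_scalar_mx. Qed.

(** If [A x] were nonzero, a small step from [x] along [- A x] would make the
    form negative, its first order term being [- 2 |A x|^2]. *)
Lemma psd_null n (A : 'M[R]_n) (x : 'cV[R]_n) : A^T = A ->
  (forall y, 0 <= quadf A y) -> quadf A x = 0 -> A *m x = 0.
Proof.
move=> As psd x0; apply/eqP; rewrite -dotp_eq0.
set g := dotp _ _; pose h := quadf A (A *m x).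
have h0 : 0 <= h by apply: psd.
(* The optimal step would be [g / h]; [h + 1] avoids the case [h = 0]. *)
have := psd (x + - (g / (h + 1)) *: (A *m x)).
rewrite quadfD // x0 quadfZ dotpZl -/g -/h add0r.
have -> : 2 * (- (g / (h + 1)) * g) + (- (g / (h + 1))) ^+ 2 * h =
   - (g ^+ 2 * (h + 2) / (h + 1) ^+ 2) by field; rewrite gt_eqF ?ltr_wpDl.
rewrite oppr_ge0 pmulr_lle0 ?invr_gt0 ?exprn_gt0 ?ltr_wpDl //.
rewrite pmulr_lle0 ?ltr_wpDl // => g2.
by rewrite -sqrf_eq0 eq_le g2 sqr_ge0.
Qed.

(** The equation in [s] is quadratic with a nonnegative discriminant, because
    [z] lies inside the ball. *)
Lemma line_meets_sphere n (z d : 'cV[R]_n) (D : R) : dotp z z <= D -> d != 0 ->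
  exists s, dotp (z + s *: d) (z + s *: d) = D.
Proof.
move=> zD d0; have d_gt0 : 0 < dotp d d by rewrite dotp_gt0.
set p := dotp z d; set q := dotp d d in d_gt0 *.
pose disc := p ^+ 2 + q * (D - dotp z z).
have disc0 : 0 <= disc by rewrite addr_ge0 ?sqr_ge0 // mulr_ge0 ?subr_ge0 // ltW.
exists ((- p + Num.sqrt disc) / q).
set s := _ / q.
have sq : s * q = - p + Num.sqrt disc by rewrite divfK // gt_eqF.
have h : (s * q + p) ^+ 2 = disc by rewrite sq addrC addrA subrr add0r sqr_sqrtr.
rewrite !(dotpDl, dotpDr, dotpZl, dotpZr) (dotpC d z) -/p -/q.
have q0 : q != 0 by rewrite gt_eqF.
apply: (mulfI q0); move: h; rewrite /disc => h.
have : (s * q + p) ^+ 2 - p ^+ 2 = q * (D - dotp z z) by rewrite h; ring.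
move=> h2; have -> : q * D = q * (D - dotp z z) + q * dotp z z by ring.
rewrite -h2; ring.
Qed.

End DotProduct.

(** * Existence of minimisers *)

Section Compactness.
Context {R : realType}.
Local Open Scope classical_set_scope.

Lemma continuous_sum {T : topologicalType} (I : Type) (r : seq I)
    (F : I -> T -> R) : (forall i, continuous (F i)) ->
  continuous (fun x => \sum_(i <- r) F i x).
Proof.
move=> cF; elim: r => [|i r IH].
  under eq_fun do rewrite big_nil.
  exact: cst_continuous.
under eq_fun do rewrite big_cons.
by move=> x; apply: (@continuousD _ R^o); [exact: cF | exact: IH].
Qed.

Lemma continuous_dotp {T : topologicalType} n (f g : T -> 'cV[R]_n) :
    (forall i, continuous (fun x => f x i 0)) ->
    (forall i, continuous (fun x => g x i 0)) ->
  continuous (fun x => dotp (f x) (g x)).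
Proof.
move=> cf cg; under eq_fun do rewrite dotpE.
by apply: continuous_sum => i x; apply: continuousM; [exact: cf | exact: cg].
Qed.

Lemma continuous_coord_tr n i : continuous (fun v : 'rV[R]_n => v^T i 0).
Proof. under eq_fun do rewrite mxE; exact: coord_continuous. Qed.

Lemma continuous_quadf n (A : 'M[R]_n) :
  continuous (fun v : 'rV[R]_n => quadf A v^T).
Proof.
under eq_fun do rewrite quadfE.
apply: continuous_dotp => i; first exact: continuous_coord_tr.
under eq_fun do rewrite mxE.
apply: continuous_sum => j x; apply: continuousM; first exact: cst_continuous.
exact: continuous_coord_tr.
Qed.

Lemma continuous_dotp_cst n (b : 'cV[R]_n) :
  continuous (fun v : 'rV[R]_n => dotp b v^T).
Proof.
apply: continuous_dotp => i; first exact: cst_continuous.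
exact: continuous_coord_tr.
Qed.

(** The feasible set is cut out by a spherical shell [L <= |x|^2 <= D] and a
    half-space: [L = D] gives a sphere, [L = 0] a ball, and [b = c = 0] removes
    the half-space. *)
Lemma quad_attains_min n (A : 'M[R]_n) (a b : 'cV[R]_n) (c L D : R) :
    (exists x, L <= dotp x x <= D /\ dotp b x <= c) ->
  exists x, [/\ L <= dotp x x <= D, dotp b x <= c &
    forall y, L <= dotp y y <= D -> dotp b y <= c ->
      etrs_obj A a x <= etrs_obj A a y].
Proof.
move=> [x0 [/andP[x0L x0D] x0c]].
pose q (v : 'rV[R]_n) := dotp v^T v^T.
have cq : continuous q by apply: continuous_dotp => i; exact: continuous_coord_tr.
pose S := [set v : 'rV[R]_n | q v <= D] `&` [set v : 'rV[R]_n | L <= q v]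
   `&` [set v : 'rV[R]_n | dotp b v^T <= c].
have clS : closed S.
  apply: closedI; [apply: closedI|].
  - by apply: (preimage_closed _ (@closed_le _ D)) => v _; exact: cq.
  - by apply: (preimage_closed _ (@closed_ge _ L)) => v _; exact: cq.
  - apply: (preimage_closed _ (@closed_le _ c)) => v _.
    exact: continuous_dotp_cst.
have bS : bounded_set S.
  (* [D + 1] dominates both [D] and the square root of [D]. *)
  exists (D + 1); split; first exact: num_real.
  move=> M DM v [[vD _] _]; rewrite /Num.norm /= mx_normrE.
  have D0 : 0 <= D by apply: le_trans vD; exact: dotp_ge0.
  have M0 : 0 <= M by rewrite ltW // (le_lt_trans _ DM) // addr_ge0.
  apply/bigmax_leP; split => // -[i j] _ /=; rewrite (ord1 i).
  have : v 0 j ^+ 2 <= D.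
    apply: le_trans vD; rewrite /q dotpE (bigD1 j) //= !mxE -expr2 lerDl.
    by apply: sumr_ge0 => k _; rewrite -expr2 sqr_ge0.
  move=> vD1; rewrite -(@ler_pXn2r _ 2) ?nnegrE // real_normK ?num_real //.
  apply: (le_trans vD1); apply: (@le_trans _ _ (D + 1)); first by rewrite lerDl.
  apply: (le_trans (ltW DM)); rewrite expr2 ler_peMl //.
  by rewrite ltW // (le_lt_trans _ DM) // lerDr.
have [||] := @compact_EVT_min _ R (fun v : 'rV[R]_n => etrs_obj A a v^T) S _
    (bounded_closed_compact bS clS).
- by exists x0^T; rewrite /S /q /= trmxK.
- apply: continuous_subspaceT => v.
  rewrite /etrs_obj; apply: (@continuousB _ R^o _ (fun v : 'rV[R]_n => quadf A v^T)
    (fun v : 'rV[R]_n => 2 * dotp a v^T)).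
    exact: continuous_quadf.
  apply: continuousM; first exact: cst_continuous.
  exact: continuous_dotp_cst.
move=> v /set_mem [[vD vL] vc] vmin; exists v^T; split => //.
  exact/andP.
move=> y /andP[yL yD] yc; have := vmin y^T; rewrite trmxK; apply.
by apply: mem_set; rewrite /S /q /= trmxK.
Qed.

End Compactness.

(** * The smallest eigenvalue of a symmetric matrix *)

Section SmallestEigenvalue.
Context {R : realType}.

Lemma eigenvalue_symP n (S : 'M[R]_n) nu : S^T = S ->
  eigenvalue S nu <-> exists2 v : 'cV[R]_n, v != 0 & S *m v = nu *: v.
Proof.
move=> Ss; split.
  move=> /eigenvalueP[v vS v0]; exists v^T; first by rewrite trmx_eq0.
  by rewrite -{1}Ss -trmx_mul vS linearZ.
move=> [v v0 Sv]; apply/eigenvalueP; exists v^T; last by rewrite trmx_eq0.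
by rewrite -{1}Ss -trmx_mul Sv linearZ.
Qed.

Lemma lambda_min_eq n (S : 'M[R]_n) s (v : 'cV[R]_n) : S^T = S -> v != 0 ->
  S *m v = s *: v -> (forall x, s * dotp x x <= quadf S x) -> lambda_min S = s.
Proof.
move=> Ss v0 Sv Sge; rewrite /lambda_min; apply: xget_unique.
  split; first by apply/eigenvalue_symP => //; exists v.
  move=> nu /(eigenvalue_symP _ Ss)[w w0 Sw].
  have := Sge w; rewrite quadfE Sw dotpZr ler_pM2r //.
  by rewrite dotp_gt0.
move=> y [/(eigenvalue_symP _ Ss)[w w0 Sw] ymin]; apply/eqP; rewrite eq_le.
apply/andP; split; first by apply: ymin; apply/eigenvalue_symP => //; exists v.
have := Sge w; rewrite quadfE Sw dotpZr ler_pM2r //.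
by rewrite dotp_gt0.
Qed.

Lemma sphere_nonempty n (D : R) : (0 < n)%N -> 0 <= D ->
  exists x : 'cV[R]_n, dotp x x = D.
Proof.
case: n => // n _ D0.
have D0' : @dotp R n.+1 0 0 <= D by rewrite dotp0l.
have one_neq0 : const_mx 1 != 0 :> 'cV[R]_n.+1.
  by apply/eqP => /matrixP/(_ 0 0)/eqP; rewrite !mxE oner_eq0.
by have [s <-] := line_meets_sphere D0' one_neq0; exists (0 + s *: const_mx 1).
Qed.

(** The smallest eigenvalue of a symmetric matrix is the minimum of its form on
    the unit sphere: a minimiser is a null vector of a semidefinite form, hence
    an eigenvector. *)
Lemma lambda_minP n (S : 'M[R]_n) : (0 < n)%N -> S^T = S ->
  (exists2 v : 'cV[R]_n, v != 0 & S *m v = lambda_min S *: v) /\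
  forall x, lambda_min S * dotp x x <= quadf S x.
Proof.
move=> n0 Ss; have [x0 x01] := sphere_nonempty n0 (@ler01 R).
have [|x [/andP[xge xle] _ xmin]] := @quad_attains_min R n S 0 0 0 1 1.
  by exists x0; rewrite x01 lexx dotp0l.
have x1 : dotp x x = 1 by apply/eqP; rewrite eq_le xle xge.
have x_neq0 : x != 0 by rewrite -dotp_gt0 x1.
have psd y : quadf S x * dotp y y <= quadf S y.
  have [->|y0] := eqVneq y 0; first by rewrite quadf0 dotp0l mulr0.
  have yy : 0 < dotp y y by rewrite dotp_gt0.
  have sy : Num.sqrt (dotp y y) ^+ 2 = dotp y y by rewrite sqr_sqrtr // ltW.
  have y_unit : dotp ((Num.sqrt (dotp y y))^-1 *: y)
                     ((Num.sqrt (dotp y y))^-1 *: y) = 1.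
    by rewrite dotpZl dotpZr mulrA -expr2 exprVn sy mulVf // gt_eqF.
  have := xmin ((Num.sqrt (dotp y y))^-1 *: y).
  rewrite y_unit lexx !dotp0l /etrs_obj !dotp0l mulr0 !subr0 quadfZ exprVn sy.
  by move=> /(_ isT (lexx _)); rewrite mulrC ler_pdivlMr.
have Sx : S *m x = quadf S x *: x.
  apply/eqP; rewrite -subr_eq0 -mul_scalar_mx -mulmxBl; apply/eqP.
  apply: psd_null; first exact: shift_sym.
    by move=> y; rewrite quadf_shift subr_ge0.
  by rewrite quadf_shift x1 mulr1 subrr.
rewrite (lambda_min_eq Ss x_neq0 Sx psd); split => //.
by exists x.
Qed.

End SmallestEigenvalue.

(** * Optimality on a sphere *)

(** The limit [e -> 0] of the hypothesis, in the form needed to extract first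
    order conditions from polynomial inequalities in a perturbation [e]. *)
Lemma small_cubic_le0 {R : realType} (c0 c1 c2 c3 : R) :
  (forall e, 0 < e -> e <= 1 -> c0 <= e * (c1 + e * c2 + e ^+ 2 * c3)) ->
  c0 <= 0.
Proof.
move=> h; rewrite leNgt; apply/negP => c00.
(* Bounds the cubic factor strictly; adding [c0] ensures [c0 / C <= 1]. *)
pose C := `|c1| + `|c2| + `|c3| + 1 + c0.
have C0 : 0 < C by rewrite ltr_wpDl // !addr_ge0.
have e0 : 0 < c0 / C by rewrite divr_gt0.
have e1 : c0 / C <= 1 by rewrite ler_pdivrMr // mul1r lerDr !addr_ge0.
have := h _ e0 e1; apply/negP; rewrite -ltNge.
have ceC : c0 = c0 / C * C by rewrite divfK // gt_eqF.
rewrite [X in _ < X]ceC ltr_pM2l //.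
set e := c0 / C in e0 e1 *.
have n1 := ler_norm c1.
have n2 : e * c2 <= `|c2|.
  apply: (le_trans (ler_norm _)); rewrite normrM gtr0_norm //.
  by rewrite ler_piMl.
have n3 : e ^+ 2 * c3 <= `|c3|.
  apply: (le_trans (ler_norm _)); rewrite normrM gtr0_norm ?exprn_gt0 //.
  by rewrite ler_piMl // exprn_ile1 // ltW.
rewrite /C; lra.
Qed.

Section SphereOptimality.
Context {R : realType} (n : nat) (A : 'M[R]_n).
Context (A_sym : A^T = A).

Lemma obj_diff (a x z : 'cV[R]_n) :
  etrs_obj A a (x + z) - etrs_obj A a x
    = quadf A z + 2 * dotp z (A *m x - a).
Proof.
rewrite /etrs_obj quadfD // !dotpDr dotpNr (dotpC a z); ring.
Qed.

(** Comparing [x] with its mirror image across the hyperplane orthogonal to [d]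
    replaces curves on the sphere by a single polynomial inequality. *)
Lemma reflection_ineq (a x d : 'cV[R]_n) :
  (forall y, dotp y y = dotp x x -> etrs_obj A a x <= etrs_obj A a y) ->
  dotp d x * dotp d d * dotp d (A *m x - a) <= dotp d x ^+ 2 * quadf A d.
Proof.
move=> xmin; have [->|d0] := eqVneq d 0; first by rewrite quadf0 !dotp0l !mul0r mulr0.
have dd : 0 < dotp d d by rewrite dotp_gt0.
have dn : dotp d d != 0 by rewrite gt_eqF.
set s := - (2 * dotp d x / dotp d d).
have hs : s * dotp d d = - (2 * dotp d x) by rewrite /s; field.
have xsd : dotp (x + s *: d) (x + s *: d) = dotp x x.
  by rewrite !(dotpDl, dotpDr, dotpZl, dotpZr) hs (dotpC x d); ring.
have := xmin _ xsd; rewrite -subr_ge0 obj_diff quadfZ dotpZl.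
set g := dotp d (A *m x - a); set q := quadf A d.
have -> : s ^+ 2 * q + 2 * (s * g) =
   4 / dotp d d ^+ 2 * (dotp d x ^+ 2 * q - dotp d x * dotp d d * g).
  by rewrite /s; field.
by rewrite pmulr_rge0 ?divr_gt0 ?exprn_gt0 // subr_ge0.
Qed.

(** First order: for [u] orthogonal to [x], reflecting along [u + e x] with
    [e] small shows that the residual [A x - a] is orthogonal to [u].
    Second order: the reflection inequality then says that [A - s] is
    nonnegative on every [d] not orthogonal to [x], and by density on all. *)
Lemma sphere_min_kkt (a x : 'cV[R]_n) : 0 < dotp x x ->
  (forall y, dotp y y = dotp x x -> etrs_obj A a x <= etrs_obj A a y) ->
  exists s, (A - s%:M) *m x = a /\ forall d, 0 <= quadf (A - s%:M) d.
Proof.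
move=> xx xmin; set g := A *m x - a.
have half u : dotp u x = 0 -> dotp u g <= 0.
  move=> ux; have [->|u0] := eqVneq u 0; first by rewrite dotp0l.
  have uu : 0 < dotp u u by rewrite dotp_gt0.
  rewrite -(pmulr_rle0 _ uu).
  set D := dotp x x in xx *.
  (* The reflection inequality along [u + e x], divided by [e |x|^2], with its
     terms sorted by powers of [e]. *)
  apply: (@small_cubic_le0 R _ (D * quadf A u - dotp u u * dotp x g)
    (2 * D * dotp x (A *m u) - D * dotp u g) (D * quadf A x - D * dotp x g)).
  move=> e e0 e1; have := reflection_ineq (u + e *: x) xmin.
  rewrite -/g quadfD // quadfZ !(dotpDl, dotpDr, dotpZl, dotpZr) (dotpC x u) ux -/D.
  rewrite !mulr0 !add0r !addr0.
  have eD : 0 < e * D by rewrite mulr_gt0.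
  rewrite expr2 -[X in X <= _]mulrA -[X in _ <= X]mulrA ler_pM2l // => h.
  rewrite -subr_ge0 in h; rewrite -subr_ge0.
  by apply: (le_trans h); rewrite le_eqVlt; apply/orP; left; apply/eqP; ring.
have orth u : dotp u x = 0 -> dotp u g = 0.
  move=> ux; apply/eqP; rewrite eq_le half //= -oppr_le0 -dotpNl.
  by apply: half; rewrite dotpNl ux oppr0.
pose s := dotp x g / dotp x x.
have xn : dotp x x != 0 by rewrite gt_eqF.
have gs : g = s *: x.
  apply/eqP; rewrite -subr_eq0 -dotp_eq0; set u := g - _.
  have ux : dotp u x = 0.
    by rewrite dotpDl dotpNl dotpZl (dotpC g) /s divfK // subrr.
  by rewrite {2}/u dotpDr dotpNr dotpZr orth // ux mulr0 subrr.
exists s; split.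
  rewrite mulmxBl mul_scalar_mx -gs /g opprB addrC subrK //.
have psd d : dotp d x != 0 -> 0 <= quadf (A - s%:M) d.
  move=> dx; have := reflection_ineq d xmin.
  rewrite -/g gs dotpZr quadf_shift -subr_ge0 => h.
  have dx2 : 0 < dotp d x ^+ 2 by rewrite exprn_even_gt0.
  rewrite -(pmulr_rge0 _ dx2); apply: (le_trans h).
  by rewrite le_eqVlt; apply/orP; left; apply/eqP; ring.
move=> d; have [dx|] := eqVneq (dotp d x) 0; last exact: psd.
rewrite -oppr_le0; set B := A - _ in psd *.
apply: (@small_cubic_le0 R _ (2 * dotp x (B *m d)) (quadf B x) 0) => e e0 e1.
have := psd (d + e *: x).
rewrite dotpDl dx dotpZl add0r mulf_neq0 ?gt_eqF // quadfD; last exact: shift_sym.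
rewrite quadfZ dotpZl => /(_ isT) h; rewrite -subr_ge0; apply: (le_trans h).
by rewrite le_eqVlt; apply/orP; left; apply/eqP; ring.
Qed.

End SphereOptimality.

(** * Lagrangian duality *)

Section LagrangianDuality.
Context {R : realType} (n : nat).
Context (A : 'M[R]_n) (a b : 'cV[R]_n) (c Delta : R).
Context (A_sym : A^T = A).

Lemma etrs_lagrangianE l1 l2 (x : 'cV[R]_n) :
  etrs_lagrangian A a b c Delta l1 l2 x
    = etrs_obj A a x + l1 * (dotp x x - Delta) + l2 * (dotp b x - c).
Proof. by rewrite /etrs_lagrangian enorm_sqr. Qed.

Lemma weak_duality : (dual_value A a b c Delta <= primal_value A a b c Delta)%E.
Proof.
apply: ge_ereal_sup => _ [[l1 l2] /= [l1_ge0 l2_ge0] <-].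
apply: le_ereal_inf_tmp => _ [x [/= xD xc] <-].
apply: ge_ereal_inf; exists (etrs_lagrangian A a b c Delta l1 l2 x)%:E.
  by exists x.
rewrite lee_fin /etrs_lagrangian.
have : l1 * (enorm x ^+ 2 - Delta) <= 0 by rewrite mulr_ge0_le0 // subr_le0.
have : l2 * (dotp b x - c) <= 0 by rewrite mulr_ge0_le0 // subr_le0.
lra.
Qed.

(** The Lagrangian is quadratic in [y] with leading form [A - s] when its first
    multiplier is [- s], so at a critical point only that form remains. *)
Lemma lagrangian_at_stationary s l (x y : 'cV[R]_n) :
  (A - s%:M) *m x = a - (l / 2) *: b ->
  etrs_lagrangian A a b c Delta (- s) l y
    = etrs_lagrangian A a b c Delta (- s) l x + quadf (A - s%:M) (y - x).
Proof.
move=> stat; rewrite -{1}[y](subrK x) (addrC _ x); move: (y - x) => z.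
have hz := congr1 (dotp z) stat.
move: hz; rewrite mulmxBl mul_scalar_mx !(dotpDr, dotpNr, dotpZr) => hz.
rewrite !etrs_lagrangianE /etrs_obj quadf_shift quadfD //.
rewrite !(dotpDl, dotpDr) (dotpC x z) (dotpC a z) (dotpC b z).
have -> : dotp z (A *m x) = dotp z a - l / 2 * dotp z b + s * dotp z x.
  by rewrite -hz subrK.
by field.
Qed.

(** By the previous expansion the objective value at [x] is a value of the dual
    function, and weak duality leaves no room between them. *)
Lemma kkt_strong_duality s l (x : 'cV[R]_n) : s <= 0 -> 0 <= l ->
  (forall y, 0 <= quadf (A - s%:M) y) ->
  (A - s%:M) *m x = a - (l / 2) *: b ->
  dotp x x <= Delta -> s * (dotp x x - Delta) = 0 ->
  dotp b x <= c -> l * (dotp b x - c) = 0 ->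
  strong_duality A a b c Delta.
Proof.
move=> s_le0 l_ge0 psd stat xD sx xc lx; apply/le_anti/andP.
split; last exact: weak_duality.
apply: (@le_trans _ _ (etrs_obj A a x)%:E).
  apply: ge_ereal_inf; exists (etrs_obj A a x)%:E => //.
  by exists x => //; split; rewrite // enorm_sqr.
apply: le_ereal_sup_tmp; exists (dual_function A a b c Delta (- s) l).
  by exists (- s, l) => //=; rewrite oppr_ge0.
apply: le_ereal_inf_tmp => _ [y _ <-]; rewrite lee_fin.
rewrite (lagrangian_at_stationary y stat) etrs_lagrangianE lx mulNr sx.
by rewrite oppr0 !addr0 lerDl psd.
Qed.

End LagrangianDuality.

(** * The eigenvalue problem as a dual of the sphere problem *)

Section Homogenization.
Context {R : realType} (n : nat).
Context (A : 'M[R]_n) (a b : 'cV[R]_n) (c Delta : R).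
Context (A_sym : A^T = A).

Definition lifted (s : R) (y : 'cV[R]_n) : 'cV[R]_(1 + n) := col_mx s%:M y.

Lemma liftedP (z : 'cV[R]_(1 + n)) : exists s y, z = lifted s y.
Proof.
exists (usubmx z 0 0), (dsubmx z).
by rewrite /lifted -mx11_scalar vsubmxK.
Qed.

Lemma dotp_lifted s y s' y' : dotp (lifted s y) (lifted s' y') = s * s' + dotp y y'.
Proof.
rewrite /dotp /lifted tr_col_mx mul_row_col mxE tr_scalar_mx -scalar_mxM mxE.
by rewrite eqxx mulr1n.
Qed.

Lemma Dmx_lifted t l s y : Dmx A a b t l *m lifted s y =
  lifted (t * s - dotp (a - (l / 2) *: b) y) (A *m y - s *: (a - (l / 2) *: b)).
Proof.
rewrite /Dmx /lifted /= mul_block_col -scalar_mxM mul_mx_scalar.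
have -> : - a + (l / 2) *: b = - (a - (l / 2) *: b) by rewrite opprB addrC.
set v := a - _; congr col_mx.
  rewrite linearN /= mulNmx (mx11_scalar (v^T *m y)) -/(dotp v y).
  by apply/matrixP => i j; rewrite !mxE !ord1 eqxx !mulr1n.
by rewrite scalerN addrC.
Qed.

Lemma Dmx_sym t l : (Dmx A a b t l)^T = Dmx A a b t l.
Proof. by rewrite /Dmx /= tr_block_mx tr_scalar_mx trmxK A_sym. Qed.

(** On (1, x) with [|x|^2 = Delta] this form is [t] plus the objective with
    linear term [a - (l / 2) b]: this is why eigenvalues of [Dmx] bound the
    Lagrangian on the sphere. *)
Lemma quadf_Dmx t l s y : quadf (Dmx A a b t l) (lifted s y) =
  t * s ^+ 2 - 2 * s * dotp (a - (l / 2) *: b) y + quadf A y.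
Proof.
rewrite quadfE Dmx_lifted dotp_lifted dotpDr dotpNr dotpZr -quadfE.
rewrite (dotpC y); ring.
Qed.

Lemma lambda_min_Dmx_le t l s y :
  lambda_min (Dmx A a b t l) * (s ^+ 2 + dotp y y) <=
  t * s ^+ 2 - 2 * s * dotp (a - (l / 2) *: b) y + quadf A y.
Proof.
have [_ /(_ (lifted s y))] := lambda_minP (ltn0Sn n) (Dmx_sym t l).
by rewrite dotp_lifted quadf_Dmx.
Qed.

(** Only the linear constraint is relaxed; the norm is kept as a constraint,
    which will be [|x|^2 = Delta]. *)
Definition partial_lagrangian l (x : 'cV[R]_n) := etrs_obj A a x + l * (dotp b x - c).

Lemma kfun_le_lagrangian t l x : dotp x x = Delta ->
  kfun A a b c Delta t l <= partial_lagrangian l x.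
Proof.
move=> xD; have := lambda_min_Dmx_le t l 1 x.
rewrite /kfun /partial_lagrangian /etrs_obj dotpDl dotpNl dotpZl xD.
rewrite expr1n mulrC (addrC 1); lra.
Qed.

(** Equality in the Rayleigh bound makes (1, x) an eigenvector of [Dmx], whose
    lower block is the claimed equation. *)
Lemma kfun_attained_stationary t l x : dotp x x = Delta ->
  partial_lagrangian l x <= kfun A a b c Delta t l ->
  (A - (lambda_min (Dmx A a b t l))%:M) *m x = a - (l / 2) *: b.
Proof.
move=> xD; rewrite /kfun /partial_lagrangian; set m := lambda_min _ => le_k.
have Ds : (Dmx A a b t l - m%:M)^T = Dmx A a b t l - m%:M.
  by apply: shift_sym; exact: Dmx_sym.
have psd z : 0 <= quadf (Dmx A a b t l - m%:M) z.
  by rewrite quadf_shift subr_ge0; apply: (lambda_minP (ltn0Sn n) (Dmx_sym t l)).2.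
have /(psd_null Ds psd) : quadf (Dmx A a b t l - m%:M) (lifted 1 x) = 0.
  apply/eqP; rewrite eq_le psd andbT quadf_shift dotp_lifted quadf_Dmx xD.
  by move: le_k; rewrite /etrs_obj dotpDl dotpNl dotpZl; lra.
rewrite mulmxBl mul_scalar_mx Dmx_lifted scale1r => /eqP.
rewrite subr_eq0 /lifted scale_col_mx => /eqP/eq_col_mx[_ h].
by rewrite mulmxBl mul_scalar_mx -h opprB addrC subrK.
Qed.

(** The multiplier [s] of a minimiser [x] of the Lagrangian on the sphere
    provides the value [t = s + a_l^T x] of the parameter for which the lifted
    vector (1, x) is an eigenvector of the smallest eigenvalue [s]. *)
Lemma kfun_attains l : (0 < n)%N -> 0 < Delta ->
  exists t x, dotp x x = Delta /\ kfun A a b c Delta t l = partial_lagrangian l x.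
Proof.
move=> n0 D0; set al := a - (l / 2) *: b.
have [x0 x0D] := sphere_nonempty n0 (ltW D0).
have [|x [/andP[xge xle] _ xmin]] := @quad_attains_min R n A al 0 0 Delta Delta.
  by exists x0; rewrite x0D lexx dotp0l.
have xD : dotp x x = Delta by apply/eqP; rewrite eq_le xle xge.
have [||s [stat psd]] := @sphere_min_kkt R n A A_sym al x.
- by rewrite xD.
- by move=> y; rewrite xD => yD; apply: xmin; rewrite ?yD ?lexx // dotp0l.
pose t := s + dotp al x; exists t, x; split => //.
have Ax : A *m x = al + s *: x.
  by apply/eqP; rewrite -subr_eq -mul_scalar_mx -mulmxBl stat.
have lifted_neq0 : lifted 1 x != 0.
  by rewrite -dotp_gt0 dotp_lifted mulr1 ltr_pwDl // dotp_ge0.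
have eig : Dmx A a b t l *m lifted 1 x = s *: lifted 1 x.
  rewrite Dmx_lifted -/al Ax scale1r (addrC al) addrK /t mulr1 addrK.
  by rewrite /lifted scale_col_mx scale_scalar_mx mulr1.
have mD : lambda_min (Dmx A a b t l) = s.
  apply: (lambda_min_eq (Dmx_sym t l) lifted_neq0 eig) => z.
  have [u [y ->]] := liftedP z; rewrite dotp_lifted quadf_Dmx -/al -subr_ge0.
  (* Completing the square: the form of [Dmx - s] at [(u, y)] is that of [A - s]
     at [y - u x]. *)
  apply: le_trans (psd (y + (- u) *: x)) _.
  rewrite quadfD; last exact: shift_sym.
  have qx : quadf (A - s%:M) x = dotp al x by rewrite quadfE stat dotpC.
  have yx : dotp ((- u) *: x) ((A - s%:M) *m y) = - u * dotp al y.
    by rewrite dotpZl (dotp_sym (shift_sym s A_sym)) stat (dotpC y).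
  rewrite quadfZ qx yx quadf_shift /t; lra.
rewrite /kfun mD /partial_lagrangian /etrs_obj quadfE Ax dotpDr dotpZr xD.
rewrite /t /al !(dotpDr, dotpDl, dotpNr, dotpNl, dotpZr, dotpZl).
rewrite (dotpC x a) (dotpC x b); by field.
Qed.

End Homogenization.

(** * Algebraic and geometric multiplicity *)

Section SymmetricMultiplicity.
Context {R : realType}.

(** Conjugation is stated without inverses, so that [T] may be a block matrix
    read off from the action of [S] on the rows of [P]. *)
Lemma char_poly_conj n (P S T : 'M[R]_n) : P \in unitmx ->
  P *m S = T *m P -> char_poly S = char_poly T.
Proof.
move=> Pu PS.
have Pp : map_mx polyC P *m char_poly_mx S = char_poly_mx T *m map_mx polyC P.
  rewrite /char_poly_mx mulmxBr mulmxBl -!map_mxM PS.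
  by rewrite mul_scalar_mx mul_mx_scalar.
have := congr1 determinant Pp; rewrite !det_mulmx mulrC => /mulIf; apply.
by rewrite det_map_mx polyC_eq0 -unitfE -unitmxE.
Qed.

Lemma mup_char_poly_split n p q (E : (p + q = n)%N) (S : 'M[R]_n) s
    (K : 'M[R]_(p, n)) (J : 'M[R]_(q, n)) (C : 'M[R]_q) :
  K *m S = s *: K -> J *m S = C *m J -> row_free (col_mx K J) ->
  ~~ root (char_poly C) s -> mup s (char_poly S) = p.
Proof.
case: n / E S K J => S K J KS JS KJ Cs.
rewrite (@char_poly_conj _ (col_mx K J) S (block_mx s%:M 0 0 C)); first last.
- by rewrite mul_col_mx KS JS mul_block_col !mul0mx addr0 add0r mul_scalar_mx.
- by rewrite -row_free_unit.
rewrite /char_poly char_block_diag_mx det_ublock mupMl //.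
have -> : char_poly_mx (s%:M : 'M[R]_p) = ('X - s%:P)%:M.
  by rewrite /char_poly_mx map_scalar_mx /= -raddfB.
by rewrite det_scalar mup_XsubCX eqxx.
Qed.

(** Symmetry makes the row space of [B = S - s] a complement of its kernel, so
    [S] splits as the scalar [s] on the kernel plus a block on the row space of
    which [s] is not an eigenvalue. *)
Lemma multiplicity_sym n (S : 'M[R]_n) s : S^T = S ->
  multiplicity S s = \rank (kermx (S - s%:M)).
Proof.
move=> Ss; set B := S - s%:M.
have Bs : B^T = B by apply: shift_sym.
have ker_cap (u : 'rV[R]_n) : u *m B = 0 -> (u <= B)%MS -> u = 0.
  move=> uB /submxP[w uE]; apply: trmx_inj; apply/eqP.
  rewrite trmx0 -dotp_eq0 /dotp trmxK {2}uE trmx_mul Bs mulmxA uB mul0mx mxE.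
  by [].
have E : (\rank (kermx B) + \rank B = n)%N by rewrite mxrank_ker subnK ?rank_leq_col.
pose K := row_base (kermx B); pose J := row_base B.
have SB : S = B + s%:M by rewrite subrK.
have KB : K *m B = 0 by apply/sub_kermxP; rewrite eq_row_base.
have /submxP[C JS] : (J *m S <= J)%MS.
  rewrite SB mulmxDr mul_mx_scalar addmx_sub ?scalemx_sub //.
  by rewrite (submx_trans (submxMl _ _)) // eq_row_base.
have [Kfree Jfree] : row_free K /\ row_free J by split; exact: row_base_free.
have J_sub : (J <= B)%MS by rewrite eq_row_base.
have BE : B = S - s%:M by [].
clearbody K J B.
apply: (@mup_char_poly_split n _ _ E S s K J C) => //.
- by rewrite SB mulmxDr KB add0r mul_mx_scalar.
- rewrite -kermx_eq0; apply/rowV0P => w /sub_kermxP.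
  rewrite -[w]hsubmxK mul_row_col; set w1 := lsubmx w; set w2 := rsubmx w => h.
  have J0 : w2 *m J = 0.
    apply: ker_cap; last by rewrite (submx_trans (submxMl _ _)).
    have := congr1 (mulmx^~ B) h; rewrite /= mulmxDl -!mulmxA KB mulmx0 add0r mul0mx.
    by [].
  have K0 : w1 *m K = 0 by move: h; rewrite J0 addr0.
  have -> : w1 = 0.
    by apply: (row_free_inj Kfree); rewrite mul0mx.
  have -> : w2 = 0 by apply: (row_free_inj Jfree); rewrite mul0mx.
  by rewrite row_mx0.
- rewrite -eigenvalue_root_char; apply/negP => /eigenvalueP[z zC z0].
  have zJ : z *m J = 0.
    apply: ker_cap; last by rewrite (submx_trans (submxMl _ _)).
    suff : z *m J *m (S - s%:M) = 0 by rewrite -BE.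
    by rewrite mulmxBr mul_mx_scalar -mulmxA JS mulmxA zC -scalemxAl subrr.
  move/negP: z0; apply; apply/eqP; apply: (row_free_inj Jfree).
  by rewrite mul0mx.
Qed.

Lemma multiplicity1_colinear n (S : 'M[R]_n) s (u v : 'cV[R]_n) : S^T = S ->
  multiplicity S s = 1%N -> u != 0 ->
  (S - s%:M) *m u = 0 -> (S - s%:M) *m v = 0 -> exists r, v = r *: u.
Proof.
move=> Ss; rewrite (multiplicity_sym s Ss) => rk u0 uS vS.
have Bs := shift_sym s Ss; set B := S - _ in Bs rk uS vS.
have inK (w : 'cV[R]_n) : B *m w = 0 -> (w^T <= kermx B)%MS.
  by move=> Bw; apply/sub_kermxP; rewrite -Bs -trmx_mul Bw trmx0.
have uK := inK _ uS.
have : (v^T <= u^T)%MS.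
  apply: (submx_trans (inK _ vS)); rewrite -(mxrank_leqif_sup uK) rk.
  by rewrite rank_rV trmx_eq0 u0.
by move=> /sub_rVP[r rE]; exists r; apply: trmx_inj; rewrite linearZ.
Qed.

(** The eigenvector [u] excludes multiplicity zero, so the kernel has dimension
    at least two and has a nonzero intersection with the hyperplane orthogonal
    to [b]. *)
Lemma multiplicity_neq1_orth n (S : 'M[R]_n) s (u b : 'cV[R]_n) : S^T = S ->
  multiplicity S s != 1%N -> u != 0 -> (S - s%:M) *m u = 0 ->
  exists d, [/\ d != 0, (S - s%:M) *m d = 0 & dotp b d = 0].
Proof.
move=> Ss; rewrite (multiplicity_sym s Ss) => rk u0 uS.
have Bs := shift_sym s Ss; set B := S - _ in Bs rk uS *.
have inK (w : 'cV[R]_n) : B *m w = 0 -> (w^T <= kermx B)%MS.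
  by move=> Bw; apply/sub_kermxP; rewrite -Bs -trmx_mul Bw trmx0.
have rk2 : (2 <= \rank (kermx B))%N.
  have : (1 <= \rank (kermx B))%N.
    apply: leq_trans (mxrankS (inK _ uS)).
    by rewrite rank_rV trmx_eq0 u0.
  by case: (\rank _) rk => [|[|]].
have : (kermx B :&: kermx b)%MS != 0.
  rewrite -mxrank_eq0 -lt0n.
  have := mxrank_sum_cap (kermx B) (kermx b).
  have := rank_leq_col (kermx B + kermx b)%MS.
  have := mxrank_ker b; have := rank_leq_col b.
  have := rank_leq_row b.
  lia.
move=> /rowV0Pn[w]; rewrite sub_capmx => /andP[/sub_kermxP wB /sub_kermxP wb] w0.
exists w^T; split; first by rewrite trmx_eq0.
  by rewrite -Bs -trmx_mul wB trmx0.
by rewrite dotpC /dotp trmxK wb mxE.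
Qed.

End SymmetricMultiplicity.

(** * Characterisation of the duality gap *)

Section DualGap.
Context {R : realType} (n : nat).
Context (A : 'M[R]_n) (a b : 'cV[R]_n) (c Delta : R).
Context (A_sym : A^T = A).

Lemma partial_lagrangianE l (x : 'cV[R]_n) :
  partial_lagrangian A a b c l x = etrs_obj A (a - (l / 2) *: b) x - l * c.
Proof.
by rewrite /partial_lagrangian /etrs_obj dotpDl dotpNl dotpZl; field.
Qed.

Lemma chord_norm (x1 x2 : 'cV[R]_n) r : dotp x1 x1 = dotp x2 x2 ->
  dotp (x1 + r *: (x2 - x1)) (x1 + r *: (x2 - x1))
    = dotp x1 x1 - r * (1 - r) * dotp (x2 - x1) (x2 - x1).
Proof.
move=> e12; rewrite !(dotpDl, dotpDr, dotpZl, dotpZr, dotpNl, dotpNr) -e12.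
by rewrite (dotpC x2 x1); ring.
Qed.

Lemma not_posdef_gt0 : ~ posdef A -> (0 < n)%N.
Proof.
move=> npd; rewrite lt0n; apply/eqP => n0; apply: npd.
by case: n / (esym n0) A => A0 x; rewrite flatmx0 eqxx.
Qed.

(** If every minimiser [x] of the Lagrangian on the sphere had
    [e * (b^T x - c) > 0], this would hold uniformly by compactness, and moving
    the multiplier from [l] towards [l + e] would increase the minimum.
    Directly: maximality of [k] yields, for each step [d], a point of the sphere
    in the half-space [e * (b^T x - c) <= 0] with Lagrangian value at most the
    optimum plus a multiple of [d], so the minimum over that half-space is at
    most the optimum. *)
Lemma optimal_one_sided t l e : (0 < n)%N -> 0 < Delta ->
  kfun_optimal A a b c Delta t l -> 0 <= l + e ->
  exists x, [/\ dotp x x = Delta, e * (dotp b x - c) <= 0 &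
    partial_lagrangian A a b c l x <= kfun A a b c Delta t l].
Proof.
move=> n0 D0 [l0 kmax] le0.
have step d : 0 < d -> d <= 1 -> exists x, [/\ dotp x x = Delta,
    e * (dotp b x - c) <= 0 & partial_lagrangian A a b c l x <=
      kfun A a b c Delta t l - d * (e * (dotp b x - c))].
  move=> d0 d1; have lde : 0 <= l + d * e.
    have -> : l + d * e = (1 - d) * l + d * (l + e) by ring.
    by rewrite addr_ge0 ?mulr_ge0 ?subr_ge0 // ltW.
  have [t' [x [xD kE]]] := kfun_attains a b c A_sym (l + d * e) n0 D0.
  have le_k := kmax t' _ lde.
  have ge_k := kfun_le_lagrangian a b c A_sym t l xD.
  have PE : partial_lagrangian A a b c (l + d * e) x =
     partial_lagrangian A a b c l x + d * (e * (dotp b x - c)).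
    by rewrite /partial_lagrangian; ring.
  exists x; split => //; last by rewrite lerBrDr -PE -kE.
  by rewrite -(pmulr_rle0 _ d0); move: le_k ge_k; rewrite kE PE; lra.
have [x0 [x0D x0e _]] := step 1 ltr01 (lexx _).
have [|x [/andP[xge xle] xe xmin]] :=
  @quad_attains_min R n A (a - (l / 2) *: b) (e *: b) (e * c) Delta Delta.
  by exists x0; rewrite x0D lexx dotpZl; split => //; rewrite -subr_le0 -mulrBr.
have xD : dotp x x = Delta by apply/eqP; rewrite eq_le xle xge.
exists x; split => //; first by move: xe; rewrite dotpZl mulrBr subr_le0.
rewrite -subr_le0.
apply: (@small_cubic_le0 _ _ (e * c + (e ^+ 2 * dotp b b + Delta) / 2) 0 0).
move=> d d0 d1; rewrite !mulr0 !addr0.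
have [y [yD ye yk]] := step d d0 d1.
have := xmin y; rewrite yD lexx dotpZl => /(_ isT).
rewrite -subr_le0 -mulrBr => /(_ ye) xy.
(* From [0 <= |e b + y|^2], a bound that does not depend on [y]. *)
have bound : - (e * (dotp b y - c)) <= e * c + (e ^+ 2 * dotp b b + Delta) / 2.
  have := dotp_ge0 (e *: b + y).
  rewrite !(dotpDl, dotpDr, dotpZl, dotpZr) yD (dotpC y b); lra.
have := ler_wpM2l (ltW d0) bound.
move: xy yk; rewrite !partial_lagrangianE; lra.
Qed.

(** The two one-sided conditions give minimisers [x1] and [x2] on either side of
    the hyperplane [b^T x = c]; any minimiser on the hyperplane would be a
    Karush-Kuhn-Tucker point closing the gap. Such a point exists on the chord
    [x1 x2] if [s = 0], since the norm constraint then has multiplier zero and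
    may be slack, and on the sphere through [x1] and [x2] in [x1 + ker (A - s)]
    if this kernel has dimension at least two, as that sphere is connected. *)
Lemma gap_multipliers t l : ~ posdef A -> 0 < Delta ->
  kfun_optimal A a b c Delta t l -> ~ strong_duality A a b c Delta ->
  [/\ lambda_min (Dmx A a b t l) = lambda_min A,
      lambda_min A < 0
    & 0 < l] /\
  (multiplicity A (lambda_min A) = 1%N /\
   exists x1 x2 : 'cV[R]_n,
     [/\ (A - (lambda_min A)%:M) *m x1 = a - (l / 2) *: b,
         (A - (lambda_min A)%:M) *m x2 = a - (l / 2) *: b,
         dotp x1 x1 = Delta,
         dotp x2 x2 = Delta
       & (dotp b x1 - c) * (dotp b x2 - c) < 0]).
Proof.
move=> npd D0 opt nsd; have n0 := not_posdef_gt0 npd.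
have l0 : 0 <= l by case: opt.
set s := lambda_min (Dmx A a b t l).
have psd y : 0 <= quadf (A - s%:M) y.
  have := lambda_min_Dmx_le a b A_sym t l 0 y.
  by rewrite -/s quadf_shift; lra.
have s_le0 : s <= 0.
  rewrite leNgt; apply/negP => s_gt0; apply: npd => x x0.
  have := psd x; rewrite quadf_shift subr_ge0; apply: lt_le_trans.
  by rewrite mulr_gt0 // dotp_gt0.
have kkt x : (A - s%:M) *m x = a - (l / 2) *: b -> dotp x x <= Delta ->
    s * (dotp x x - Delta) = 0 -> dotp b x <= c -> l * (dotp b x - c) = 0 -> False.
  by move=> *; apply: nsd; apply: (@kkt_strong_duality _ _ A a b c Delta A_sym s l x).
have kktS x : (A - s%:M) *m x = a - (l / 2) *: b -> dotp x x = Delta ->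
    dotp b x <= c -> l * (dotp b x - c) = 0 -> False.
  by move=> xs xD; apply: kkt; rewrite // xD // subrr mulr0.
have [x1 [x1D x1c x1k]] := optimal_one_sided n0 D0 opt (addr_ge0 l0 ler01).
have x1s := kfun_attained_stationary A_sym x1D x1k; rewrite -/s in x1s.
rewrite mul1r subr_le0 in x1c.
have l_gt0 : 0 < l.
  rewrite lt_neqAle l0 andbT; apply/eqP => l00.
  by apply: (kktS x1) => //; rewrite -l00 mul0r.
(* The direction [- l] keeps the multiplier nonnegative up to step one. *)
have [x2 [x2D x2c x2k]] : exists x, [/\ dotp x x = Delta,
    - l * (dotp b x - c) <= 0 &
    partial_lagrangian A a b c l x <= kfun A a b c Delta t l].
  by apply: optimal_one_sided => //; rewrite subrr.
have x2s := kfun_attained_stationary A_sym x2D x2k; rewrite -/s in x2s.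
rewrite mulNr oppr_le0 pmulr_rge0 // subr_ge0 in x2c.
have x1lt : dotp b x1 < c.
  rewrite lt_neqAle x1c andbT; apply/eqP => x1E.
  by apply: (kktS x1) => //; rewrite x1E subrr mulr0.
have x2gt : c < dotp b x2.
  rewrite lt_neqAle x2c andbT; apply/eqP => x2E.
  by apply: (kktS x2) => //; rewrite -x2E // subrr mulr0.
set w := x2 - x1.
have ws : (A - s%:M) *m w = 0 by rewrite /w mulmxBr x1s x2s subrr.
have w0 : w != 0.
  rewrite subr_eq0; apply/eqP => x12; move: x1lt x2gt; rewrite x12; lra.
have sE : lambda_min A = s.
  apply: (lambda_min_eq A_sym w0); last by move=> x; rewrite -subr_ge0 -quadf_shift.
  by apply/eqP; rewrite -subr_eq0 -mul_scalar_mx -mulmxBl ws.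
(* The point of the chord from [x1] to [x2] on which the constraint is tight. *)
pose r := (c - dotp b x1) / (dotp b x2 - dotp b x1).
pose z := x1 + r *: w.
have b12 : 0 < dotp b x2 - dotp b x1 by lra.
have r0 : 0 <= r by rewrite divr_ge0 // ltW //; lra.
have r1 : r <= 1 by rewrite ler_pdivrMr //; lra.
have bz : dotp b z = c.
  rewrite /z /w dotpDr dotpZr dotpDr dotpNr /r divfK ?gt_eqF //.
  by rewrite addrC subrK.
have zD : dotp z z <= Delta.
  rewrite /z /w chord_norm ?x1D ?x2D // gerBl.
  by apply: mulr_ge0 (mulr_ge0 r0 _) (dotp_ge0 _); rewrite subr_ge0.
have zs : (A - s%:M) *m z = a - (l / 2) *: b.
  by rewrite /z mulmxDr -scalemxAr ws scaler0 addr0.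
rewrite sE; split.
  split => //; rewrite lt_neqAle s_le0 andbT; apply/eqP => s0.
  by apply: (kkt z); rewrite ?bz ?subrr ?mulr0 // s0 mul0r.
split.
  apply/eqP; apply: contrapT => /negP mult.
  have [d [d0 ds bd]] := multiplicity_neq1_orth b A_sym mult w0 ws.
  (* Leave the chord along the hyperplane, inside the solution set, until the
     sphere is reached. *)
  have [q qD] := line_meets_sphere zD d0.
  have bzd : dotp b (z + q *: d) = c by rewrite dotpDr dotpZr bd mulr0 addr0.
  apply: (kktS (z + q *: d)); rewrite ?bzd ?subrr ?mulr0 //.
  by rewrite mulmxDr -scalemxAr ds scaler0 addr0.
exists x1, x2; split => //.
by rewrite nmulr_rlt0 ?subr_lt0 ?subr_gt0.
Qed.

(** At the multipliers [(- lambda_min A, l)] both [x1] and [x2] minimise the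
    Lagrangian, with value [v]. For other multipliers the quadratic constraint
    contributes nothing at [x1] and [x2], and the linear one changes the
    Lagrangian there by amounts of opposite signs, so [v] is the dual value.
    A feasible point of value at most [v] would be a minimiser of this
    Lagrangian satisfying complementarity; with a kernel of dimension one it is
    on the line [x1 x2] and on the sphere, hence is [x1] or [x2], at which the
    linear constraint is not tight. *)
Lemma multipliers_gap l : (0 < n)%N -> slater b c Delta ->
  lambda_min A < 0 -> 0 < l -> multiplicity A (lambda_min A) = 1%N ->
  (exists x1 x2 : 'cV[R]_n,
     [/\ (A - (lambda_min A)%:M) *m x1 = a - (l / 2) *: b,
         (A - (lambda_min A)%:M) *m x2 = a - (l / 2) *: b,
         dotp x1 x1 = Delta,
         dotp x2 x2 = Delta
       & (dotp b x1 - c) * (dotp b x2 - c) < 0]) ->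
  ~ strong_duality A a b c Delta.
Proof.
move=> n0 [xs [xsD xsc]] s0 l0 mult [x1 [x2 [x1s x2s x1D x2D x12]]] sd.
have psd y : 0 <= quadf (A - (lambda_min A)%:M) y.
  by rewrite quadf_shift subr_ge0; apply: (lambda_minP n0 A_sym).2.
set s := lambda_min A in s0 mult x1s x2s psd.
set w := x2 - x1.
have ws : (A - s%:M) *m w = 0 by rewrite /w mulmxBr x1s x2s subrr.
have w0 : w != 0.
  rewrite subr_eq0; apply/eqP => e; move: x12; rewrite e -expr2.
  by rewrite ltNge sqr_ge0.
pose v := partial_lagrangian A a b c l x1.
have vE : partial_lagrangian A a b c l x2 = v.
  have := lagrangian_at_stationary c Delta A_sym x2 x1s.
  rewrite -/w quadfE ws dotp0r addr0 !etrs_lagrangianE x1D x2D subrr mulr0.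
  by rewrite !addr0.
have dual_le : (dual_value A a b c Delta <= v%:E)%E.
  apply: ge_ereal_sup => _ [[l1 l2] /= [l10 l20] <-].
  have below x : dotp x x = Delta -> partial_lagrangian A a b c l x = v ->
      (l2 - l) * (dotp b x - c) <= 0 ->
      (dual_function A a b c Delta l1 l2 <= v%:E)%E.
    move=> xD xv sgn; apply: ge_ereal_inf.
    exists (etrs_lagrangian A a b c Delta l1 l2 x)%:E; first by exists x.
    rewrite lee_fin etrs_lagrangianE xD subrr mulr0 -xv /partial_lagrangian.
    lra.
  have [sgn|sgn] := leP ((l2 - l) * (dotp b x1 - c)) 0; first exact: (below x1).
  apply: (below x2) => //; rewrite leNgt; apply/negP => sgn2.
  have := mulr_gt0 sgn sgn2; rewrite mulrACA -expr2.
  by rewrite ltNge mulr_ge0_le0 // ?sqr_ge0 // ltW.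
have [|x [/andP[_ xD] xc xmin]] := @quad_attains_min R n A a b c 0 Delta.
  by exists xs; rewrite dotp_ge0 -enorm_sqr !ltW.
have primal_ge : ((etrs_obj A a x)%:E <= primal_value A a b c Delta)%E.
  apply: le_ereal_inf_tmp => _ [y [/= yD yc] <-]; rewrite lee_fin.
  by apply: xmin => //; rewrite dotp_ge0 -enorm_sqr.
have xv : etrs_obj A a x <= v.
  by rewrite -lee_fin; apply: (le_trans primal_ge); rewrite sd.
have := lagrangian_at_stationary c Delta A_sym x x1s.
rewrite !etrs_lagrangianE x1D subrr mulr0 addr0 -/(partial_lagrangian A a b c l x1) -/v.
have g1 := psd (x - x1).
have g2 : 0 <= s * (dotp x x - Delta) by rewrite mulr_le0 ?subr_le0 // ltW.
have g3 : l * (dotp b x - c) <= 0 by rewrite mulr_ge0_le0 ?subr_le0 // ltW.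
move=> Lx.
have q0 : quadf (A - s%:M) (x - x1) = 0 by lra.
have sx : s * (dotp x x - Delta) = 0 by lra.
have lx : l * (dotp b x - c) = 0 by lra.
have xD' : dotp x x = Delta.
  by apply/eqP; rewrite -subr_eq0; move/eqP: sx; rewrite mulf_eq0 lt_eqF.
have bx : dotp b x = c.
  by apply/eqP; rewrite -subr_eq0; move/eqP: lx; rewrite mulf_eq0 gt_eqF.
have xs0 := psd_null (shift_sym s A_sym) psd q0.
have [r xr] := multiplicity1_colinear A_sym mult w0 ws xs0.
have xE : x = x1 + r *: (x2 - x1) by rewrite -xr addrC subrK.
have := chord_norm r (etrans x1D (esym x2D)); rewrite -xE xD' x1D.
move=> /eqP; rewrite -subr_eq0 opprB addrC subrK !mulf_eq0 dotp_eq0 -/w (negPf w0) orbF.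
rewrite subr_eq0 => /orP[]/eqP rE; move: bx; rewrite xE.
  rewrite rE scale0r addr0 => e; move: x12; rewrite e subrr mul0r ltxx //.
rewrite -rE scale1r addrC subrK => e; move: x12; rewrite e subrr mulr0 ltxx //.
Qed.

End DualGap.

Unset Implicit Arguments.

Theorem corollary1 (R : realType) (n : nat) (A : 'M[R]_n) (a b : 'cV[R]_n)
    (c Delta : R)
    (A_sym : A^T = A) (A_npd : ~ posdef A) (Delta_gt0 : 0 < Delta)
    (Hslater : slater b c Delta)
    (ts lambdas : R) (Hopt : kfun_optimal A a b c Delta ts lambdas) :
  ~ strong_duality A a b c Delta <->
  [/\ lambda_min (Dmx A a b ts lambdas) = lambda_min A,
      lambda_min A < 0
    & 0 < lambdas] /\
  (multiplicity A (lambda_min A) = 1%N /\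
   exists x1 x2 : 'cV[R]_n,
     [/\ (A - (lambda_min A)%:M) *m x1 = a - (lambdas / 2) *: b,
         (A - (lambda_min A)%:M) *m x2 = a - (lambdas / 2) *: b,
         dotp x1 x1 = Delta,
         dotp x2 x2 = Delta
       & (dotp b x1 - c) * (dotp b x2 - c) < 0]).
Proof.
split; first exact: gap_multipliers.
move=> [[_ s0 l0] [mult xs]].
exact: (multipliers_gap A_sym (not_posdef_gt0 A_npd) Hslater s0 l0 mult xs).
Qed.
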